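(* Let $d>1$, let $X=\mathbb{R}^d$, and let $F:X\to\mathbb{R}^d$ be locally Lipschitz such that the flow $\phi^t$ of $\dot u=F(u)$ is defined for all $t\ge 0$. Let $x_1,\dots,x_n\in X$ and suppose that $F$ is discoverable in the space of continuous functions from the $n$ trajectories through $x_1,\dots,x_n$. Then one of the following holds: (1) the system is topologically transitive, and there is an $i\in\{1,\dots,n\}$ such that $F$ is discoverable in the space of continuous functions from the single trajectory through $x_i$; or (2) there are an integer $k$ with $1<k\le n$ and indices $i_1,\dots,i_k\in\{1,\dots,n\}$ such that, with $C_{i_j}=\overline{\operatorname{Traj}(x_{i_j},F)}$, each $C_{i_j}$ is a proper, closed, invariant subset of $X$, $X=C_{i_1}\cup\dots\cup C_{i_k}$, the flow restricted to each $C_{i_j}$ is topologically transitive, and $F$ is discoverable in the space of continuous functions from the $k$ trajectories through $x_{i_1},\dots,x_{i_k}$.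
   Context: $\operatorname{Traj}(x,F)=\{\phi^t(x):t\ge0\}$. A set $A$ is invariant if $\phi^t(A)\subseteq A$ for all $t\ge 0$. $F$ is discoverable in the space of continuous functions from the trajectories through $y_1,\dots,y_m$ if $F$ is the only continuous $G:\mathbb{R}^d\to\mathbb{R}^d$ such that $u_i(t)=\phi^t(y_i)$, $t\ge0$, satisfies $\dot u_i=G(u_i)$ for every $i=1,\dots,m$. The flow on an invariant set $A$ (with the subspace topology) is topologically transitive if for all non-empty relatively open $W_1,W_2\subseteq A$ there is $t>0$ with $\phi^t(W_1)\cap W_2\ne\emptyset$; the system is topologically transitive if this holds with $A=X$. *)

(* Defs.v *)
From HB Require Import structures.
From mathcomp Require Import all_boot all_order all_algebra.
From mathcomp Require Import all_classical all_reals all_analysis.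

Set Implicit Arguments.
Unset Strict Implicit.
Unset Printing Implicit Defensive.

Import Order.TTheory GRing.Theory Num.Theory numFieldNormedType.Exports.

Local Open Scope classical_set_scope.
Local Open Scope ring_scope.

Section Discoverability.
Variables (R : realType) (d : nat).
Local Notation X := 'rV[R]_d.

(* 'rV[R]_d carries the sup norm, which is equivalent to the Euclidean one. *)
Definition locally_lipschitz (F : X -> X) : Prop :=
  forall x : X, exists2 U : set X, nbhs x U & [lipschitz F y | y in U].

(* u' = G(u) on [0, +oo[, with the right derivative at 0; the values of u at
   negative times play no role. *)
Definition solves (G : X -> X) (u : R -> X) : Prop :=
  (forall t : R, 0 < t -> is_derive t 1 u (G (u t))) /\
  h^-1 *: (u h - u 0) @[h --> 0^'+] --> G (u 0).

(* Solutions exist for all t >= 0 but need not extend to negative times, so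
   phi t is constrained only for t >= 0. If F is locally Lipschitz, then
   this determines phi there. *)
Definition is_flow (F : X -> X) (phi : R -> X -> X) : Prop :=
  forall x, phi 0 x = x /\ solves F (phi^~ x).

Definition Traj (phi : R -> X -> X) (x : X) : set X :=
  [set phi t x | t in [set t | 0 <= t]].

Definition invariant_set (phi : R -> X -> X) (A : set X) : Prop :=
  forall t, 0 <= t -> phi t @` A `<=` A.

Definition discoverable (phi : R -> X -> X) (F : X -> X) (m : nat)
    (y : 'I_m -> X) : Prop :=
  unique (fun G : X -> X =>
    continuous G /\ forall i, solves G (phi^~ (y i))) F.

Definition rel_open (A W : set X) : Prop :=
  exists2 O : set X, open O & W = A `&` O.

Definition transitive_on (phi : R -> X -> X) (A : set X) : Prop :=
  forall W1 W2 : set X, rel_open A W1 -> rel_open A W2 ->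
    W1 !=set0 -> W2 !=set0 ->
    exists2 t, 0 < t & (phi t @` W1) `&` W2 !=set0.

Definition topologically_transitive (phi : R -> X -> X) : Prop :=
  transitive_on phi setT.

End Discoverability.

(* Main.v *)
Require Import Defs.
From HB Require Import structures.
From mathcomp Require Import all_boot all_order all_algebra.
From mathcomp Require Import all_classical all_reals all_analysis.
From mathcomp Require Import ring lra.
Set Implicit Arguments.
Unset Strict Implicit.
Unset Printing Implicit Defensive.
Import Order.TTheory GRing.Theory Num.Theory numFieldNormedType.Exports.
Local Open Scope classical_set_scope.
Local Open Scope ring_scope.

(** Discoverability is density in disguise. If the trajectories through the
    points [x i] miss a ball, adding to [F] a bump supported in that ball yields
    another continuous field solved by the same trajectories; conversely, a
    continuous field that these trajectories solve agrees with [F] along them,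
    hence everywhere if their union is dense ([discoverable_dense],
    [dense_discoverable]). So the closures of the trajectories cover the space,
    and we may pass to a cover [J] from which no member can be removed
    ([irredundant_subcover]).

    What remains is that each closure [C] of a trajectory in [J] is transitive.
    By irredundance, the complement [U] of the other members of [J] is a
    non-empty open set contained in [C]. The other members are invariant, so a
    trajectory that leaves [U] never comes back. On the other hand, in dimension
    at least 2 a trajectory returns, at arbitrarily late times, to every
    non-empty open set contained in its closure ([recurrence]): otherwise that
    open set would lie in a compact piece of the trajectory, which is a Lipschitz
    curve, and Lipschitz curves have empty interior
    ([lipschitz_arc_not_ball]). Hence the trajectory stays in [U], so any
    relatively open subset of [C] that is not empty meets [U], contains a
    non-empty open set of the whole space, and is visited at arbitrarily late
    times ([transitive_on_closure_Traj]). If [J] has one element, that closure is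
    the whole space and the first alternative holds; otherwise the second does.

    The invariance of closures of trajectories requires that the flow be a
    semigroup of continuous maps. This follows from uniqueness and continuous
    dependence for a locally Lipschitz field, obtained here on short time
    intervals ([local_dependence]) and propagated to all times by
    [real_induction]. *)

(** * Induction along the half-line *)

Section OrderedLine.
Variable R : realType.

(** Local properties of solutions extend to all times by this principle: the
    infimum of the times at which [P] fails would be followed by an interval on
    which [P] holds. The step at [0] is vacuous in its hypothesis, so it supplies
    the base case. *)
Lemma real_induction (P : R -> Prop) :
  (forall t, 0 <= t -> (forall s, 0 <= s < t -> P s) ->
     exists2 e, 0 < e & forall s, t <= s < t + e -> P s) ->
  forall t, 0 <= t -> P t.
Proof.
move=> step t t0; apply: contrapT => nPt.
pose S := [set s | 0 <= s /\ ~ P s].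
have infS : has_inf S by split; [exists t | exists 0 => s []].
have S0 : 0 <= inf S by apply: lb_le_inf; [exact: infS.1 | move=> s []].
have [e e0 Pe] : exists2 e, 0 < e & forall s, inf S <= s < inf S + e -> P s.
  apply: step => // s /andP[s0 sS]; apply: contrapT => nPs.
  have : inf S <= s by apply: (ge_inf infS.2); split.
  by rewrite leNgt sS.
have [s [s0 nPs] sle] := inf_adherent e0 infS.
by apply: (nPs); apply: Pe; rewrite sle andbT; apply: (ge_inf infS.2); split.
Qed.

End OrderedLine.

(** * Vector-valued mean value inequality *)

Section RowVectorNorm.
Variables (R : realType) (d : nat).
Implicit Types x : 'rV[R]_d.

Lemma coord_le_norm x j : `|x 0 j| <= `|x|.
Proof.
by rewrite [leRHS]/Num.norm/= mx_normrE; exact: (le_bigmax _ _ (0, j)).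
Qed.

Lemma norm_le_coord x (b : R) : 0 <= b -> (forall j, `|x 0 j| <= b) -> `|x| <= b.
Proof.
move=> b0 xb; rewrite [leLHS]/Num.norm/= mx_normrE; apply: bigmax_le => // -[i j] _ /=.
by rewrite (ord1 i).
Qed.

End RowVectorNorm.

Section MeanValue.
Variables (R : realType) (d : nat).
Local Notation X := 'rV[R]_d.
Implicit Types u v : R -> X.

(** There is no mean value equality for vector-valued functions, but the norm is
    the sup norm, so the scalar theorem can be applied to each coordinate. *)
Lemma mean_value_le u (u' : R -> X) (a b K : R) : a <= b -> 0 <= K ->
  {within `[a, b], continuous u} ->
  (forall t, a < t < b -> is_derive t 1 u (u' t)) ->
  (forall t, a < t < b -> `|u' t| <= K) ->
  `|u b - u a| <= K * (b - a).
Proof.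
rewrite le_eqVlt => /predU1P[<- K0 _ _ _|ab K0 cu du u'K].
  by rewrite !subrr normr0 mulr0.
apply: norm_le_coord => [|j]; first by rewrite mulr_ge0// subr_ge0 ltW.
have [t||c] := @MVT R (fun t => u t 0 j) (fun t => u' t 0 j) a b ab.
- rewrite in_itv/= => /du[udt uE]; split; first by move/derivable_mxP : udt; exact.
  by have := derive_mx udt; rewrite uE => ->; rewrite mxE.
- by move=> t; exact: cvg_comp (cu t) (@coord_continuous _ _ _ 0 j (u t)).
rewrite in_itv/= => cab; rewrite !mxE => ->.
rewrite normrM [X in _ * X]ger0_norm ?subr_ge0 ?(ltW ab)//.
rewrite ler_wpM2r ?subr_ge0 ?(ltW ab)//.
by rewrite (le_trans (coord_le_norm _ _)) ?u'K.
Qed.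

End MeanValue.

(** * Solutions of an autonomous equation *)

Section Solutions.
Variables (R : realType) (d : nat).
Local Notation X := 'rV[R]_d.
Implicit Types (F G : X -> X) (u v : R -> X).

(** At [0] only the right derivative is known to exist, which still gives
    continuity from the right. *)
Lemma solves_continuous F u : solves F u -> {within `[0, +oo[, continuous u}.
Proof.
move=> [du d0]; apply/continuous_within_itvcyP; split.
  move=> t; rewrite in_itv/= andbT => /du[udt _].
  by apply: differentiable_continuous; exact/derivable1_diffP.
have -> : u 0 = 0 *: F (u 0) + u 0 by rewrite scale0r add0r.
have : h *: (h^-1 *: (u h - u 0)) + u 0 @[h --> 0^'+] --> 0 *: F (u 0) + u 0.
  apply: cvgD; last exact: cvg_cst.
  apply: cvgZ => //.
  by apply: cvg_at_right_filter; exact: cvg_id.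
apply: cvg_trans; apply: near_eq_cvg; near=> h.
by rewrite scalerA divff ?scale1r ?subrK.
Unshelve. all: by end_near. Qed.

Lemma solves_within F u a b : solves F u -> 0 <= a ->
  {within `[a, b], continuous u}.
Proof.
move=> /solves_continuous cu a0; apply: continuous_subspaceW cu => t /=.
by rewrite !in_itv/= andbT => /andP[+ _]; exact: le_trans.
Qed.

(** The form of one-sided continuity that the real inductions below consume. *)
Lemma solves_near F u t e : solves F u -> 0 <= t -> 0 < e ->
  exists2 r, 0 < r & forall s, 0 <= s -> `|t - s| < r -> `|u t - u s| < e.
Proof.
move=> /solves_continuous/subspace_continuousP cu t0 e0.
have : `[0, +oo[%classic t by rewrite /= in_itv/= t0.
move=> /cu/cvgrPdist_lt/(_ e e0); rewrite near_withinE => -[r /= r0 ru].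
by exists r => // s s0 ts; apply: ru => //=; rewrite in_itv/= s0.
Qed.

(** At positive times the two-sided derivative restricts to the right derivative
    that the shifted solution needs at its new origin. *)
Lemma solves_shift F u s : 0 <= s -> solves F u -> solves F (fun t => u (s + t)).
Proof.
move=> s0 [du d0]; split=> [t t0|].
  have [ud uE] := du (s + t) (ltr_wpDl s0 t0).
  have sE : (fun h : R => h^-1 *: (((fun t => u (s + t)) \o shift t) (h *: 1) - u (s + t)))
      = (fun h => h^-1 *: ((u \o shift (s + t)) (h *: 1) - u (s + t))).
    by apply/funext => h /=; rewrite (addrCA s).
  by split; [rewrite /derivable sE | rewrite /derive sE].
rewrite addr0; move: s0; rewrite le_eqVlt => /predU1P[<-|s0].
  by (under eq_fun do rewrite add0r); exact: d0.
have [ud <-] := du s s0.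
have := cvg_dnbhs_at_right ud.
rewrite /derive; apply: cvg_trans; apply: near_eq_cvg; near=> h.
by rewrite /= (_ : h *: (1 : R) = h) ?(addrC s)//; exact: mulr1.
Unshelve. all: by end_near. Qed.

Lemma solves_field_eq F G u : solves F u -> solves G u ->
  forall t, 0 <= t -> F (u t) = G (u t).
Proof.
move=> [dF F0] [dG G0] t; rewrite le_eqVlt => /predU1P[<-|t0].
  exact: cvg_unique F0 G0.
by have [_ <-] := dF t t0; have [_ <-] := dG t t0.
Qed.

Lemma solves_eq_field F G u : solves F u ->
  (forall t, 0 <= t -> F (u t) = G (u t)) -> solves G u.
Proof.
move=> [dF F0] FG; split=> [t t0|]; last by rewrite -FG.
by rewrite -FG ?ltW//; exact: dF.
Qed.

End Solutions.

(** * Uniqueness and short-time dependence on initial values *)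

Section LocalDependence.
Variables (R : realType) (d : nat).
Local Notation X := 'rV[R]_d.
Implicit Types (F : X -> X) (u v : R -> X).

Lemma lipschitz_bounded_ball F z : locally_lipschitz F ->
  exists r L M : R, [/\ 0 < r, 0 < L, 0 < M,
    forall p q, `|z - p| < r -> `|z - q| < r -> `|F p - F q| <= L * `|p - q| &
    forall p, `|z - p| < r -> `|F p| <= M].
Proof.
move=> /(_ z)[U /nbhs_normP[r /= r0 rU] /pinfty_ex_gt0[L L0 LU]].
have zr : `|z - z| < r by rewrite subrr normr0.
have FL p q : `|z - p| < r -> `|z - q| < r -> `|F p - F q| <= L * `|p - q|.
  by move=> zp zq; apply: (LU (p, q)); split; exact: rU.
exists r, L, (L * r + `|F z| + 1); split=> //.
  by rewrite ltr_wpDl// addr_ge0// mulr_ge0 ?ltW.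
move=> p zp; rewrite -[F p](subrK (F z)) (le_trans (ler_normD _ _))//.
rewrite -addrA lerD ?lerDl ?ler01//.
rewrite (le_trans (FL _ _ zp zr))// ler_pM2l// distrC; exact: ltW.
Qed.

(** As long as the solution remains in the ball its speed is at most [M], so by
    time [r / (4 * M)] it has moved by at most [r / 4], and it started within
    [r / 2] of the centre. *)
Lemma solves_stays F u z r M : 0 < r -> 0 < M -> solves F u ->
  (forall p, `|z - p| < r -> `|F p| <= M) -> `|z - u 0| < r / 2 ->
  forall t, 0 <= t -> t <= r / (4 * M) -> `|z - u t| < r.
Proof.
move=> r0 M0 uF FM zu0; apply: real_induction => t t0 IH.
have [tT|Tt] := leP t (r / (4 * M)); last first.
  exists 1 => // s /andP[ts _] sT.
  by move: (lt_le_trans Tt (le_trans ts sT)); rewrite ltxx.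
have ut0 : `|u t - u 0| <= M * (t - 0).
  apply: (@mean_value_le _ _ u (F \o u)); rewrite ?(ltW M0)//.
  - exact: solves_within uF _.
  - by move=> s /andP[s0 _]; exact: uF.1.
  - move=> s /andP[s0 st]; apply: FM; apply: IH; first by rewrite (ltW s0).
    exact: ltW (lt_le_trans st tT).
have Mt : M * t <= r / 4.
  by move: tT; rewrite ler_pdivlMr ?mulr_gt0//; lra.
have [e e0 ue] := solves_near uF t0 (divr_gt0 r0 (ltr0n _ 4)).
exists e => // s /andP[ts ste] _.
have us : `|u t - u s| < r / 4.
  by apply: ue; [exact: le_trans ts | rewrite ler0_norm ?subr_le0//; lra].
have -> : z - u s = (z - u 0) - (u t - u 0) + (u t - u s).
  by rewrite opprB !addrA !subrK.
have := ler_normD ((z - u 0) - (u t - u 0)) (u t - u s).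
have := ler_normB (z - u 0) (u t - u 0).
lra.
Qed.

(** A substitute for Gronwall's inequality on a short interval. Let [m] be the
    maximum of the distance between the two solutions, attained at [s]. The
    mean value inequality gives [m <= m0 + L * m * s], where [m0] is the initial
    distance, and [L * s <= 1 / 2] for short times, whence [m <= 2 * m0]. *)
Lemma local_dependence F z : locally_lipschitz F ->
  exists r tau : R, [/\ 0 < r, 0 < tau &
    forall u v, solves F u -> solves F v ->
      `|z - u 0| < r -> `|z - v 0| < r ->
      forall t, 0 <= t <= tau -> `|u t - v t| <= 2 * `|u 0 - v 0|].
Proof.
move=> /(lipschitz_bounded_ball z)[r [L [M [r0 L0 M0 FL FM]]]].
pose tau := Num.min (r / (4 * M)) (1 / (2 * L)).
have tau0 : 0 < tau by rewrite lt_min !divr_gt0 ?mulr_gt0.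
exists (r / 2), tau; split; rewrite ?divr_gt0// => u v uF vF zu zv t ttau.
have stay w : solves F w -> `|z - w 0| < r / 2 ->
    forall s, 0 <= s <= tau -> `|z - w s| < r.
  move=> wF zw s /andP[s0]; rewrite le_min => /andP[sr _].
  exact: solves_stays r0 M0 wF FM zw s s0 sr.
pose g s := `|u s - v s|.
have cg : {within `[0, tau], continuous g}.
  move=> s; apply: cvg_norm; apply: cvgB.
    exact: (solves_within uF (lexx 0)).
  exact: (solves_within vF (lexx 0)).
have [s] := EVT_max (ltW tau0) cg.
rewrite in_itv/= => /andP[s0 stau] gs.
have gst : g t <= g s by apply: gs; rewrite in_itv.
have Lg0 : 0 <= L * g s by rewrite mulr_ge0 ?(ltW L0) /g.
have : `|(u - v) s - (u - v) 0| <= L * g s * (s - 0).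
  apply: (@mean_value_le _ _ _ (fun t => F (u t) - F (v t)) _ _ _ s0 Lg0).
  - move=> q; apply: cvgB; first exact: (solves_within uF (lexx 0)).
    exact: (solves_within vF (lexx 0)).
  - by move=> q /andP[q0 _]; apply: is_deriveB; [exact: uF.1|exact: vF.1].
  - move=> q /andP[q0 qs].
    have qtau : 0 <= q <= tau by rewrite (ltW q0) (ltW (lt_le_trans qs stau)).
    rewrite (le_trans (FL _ _ (stay _ uF zu _ qtau) (stay _ vF zv _ qtau)))//.
    by rewrite ler_pM2l//; apply: gs; rewrite in_itv.
have : L * g s * s <= g s / 2.
  rewrite mulrAC mulrC ler_wpM2l ?/g//.
  move: stau; rewrite le_min => /andP[_]; rewrite ler_pdivlMr ?mulr_gt0//; lra.
have : g s - g 0 <= `|(u - v) s - (u - v) 0| by exact: lerB_dist.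
rewrite -[`|u t - v t|]/(g t) -[`|u 0 - v 0|]/(g 0).
move: gst; lra.
Qed.

(** Agreement on [[0, t[] passes to [t] by continuity, and then beyond [t] by
    [local_dependence] applied to the solutions restarted at time [t]. *)
Lemma solves_unique F u v : locally_lipschitz F -> solves F u -> solves F v ->
  u 0 = v 0 -> forall t, 0 <= t -> u t = v t.
Proof.
move=> Flip uF vF uv0; apply: real_induction => t t0 IH.
(* Agreement at [t] is the limit of agreement at earlier times. *)
have uvt : u t = v t.
  move: t0; rewrite le_eqVlt => /predU1P[<-//|t0].
  apply/eqP; rewrite -subr_eq0 -normr_le0; apply/ler_addgt0Pl => e e0.
  rewrite addr0.
  have e2 : 0 < e / 2 by rewrite divr_gt0.
  have [a a0 ua] := solves_near uF (ltW t0) e2.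
  have [b b0 vb] := solves_near vF (ltW t0) e2.
  have [s [s0 st sa sb]] : exists s, [/\ 0 <= s, s < t, t - s < a & t - s < b].
    have m0 : 0 < Num.min t (Num.min a b) by rewrite !lt_min t0 a0.
    exists (t - Num.min t (Num.min a b) / 2).
    have : Num.min t (Num.min a b) <= t by rewrite ge_min lexx.
    have : Num.min t (Num.min a b) <= a by rewrite !ge_min lexx orbT.
    have : Num.min t (Num.min a b) <= b by rewrite !ge_min lexx !orbT.
    by move: m0; set m := Num.min _ _ => *; split; lra.
  have ts : `|t - s| = t - s by rewrite ger0_norm// subr_ge0 ltW.
  have uvs : u s = v s by apply: IH; rewrite s0.
  have -> : u t - v t = (u t - u s) - (v t - v s).
    by rewrite opprB uvs addrA subrK.
  rewrite (le_trans (ler_normB _ _))// (splitr e) lerD// ltW//.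
    by apply: ua; rewrite ?ts.
  by apply: vb; rewrite ?ts.
have [r [tau [r0 tau0 dep]]] := local_dependence (u t) Flip.
exists tau => // s /andP[ts stt].
have tst : 0 <= s - t <= tau by apply/andP; split; lra.
have ur : `|u t - u (t + 0)| < r by rewrite addr0 subrr normr0.
have vr : `|u t - v (t + 0)| < r by rewrite addr0 uvt subrr normr0.
have := dep _ _ (solves_shift t0 uF) (solves_shift t0 vF) ur vr _ tst.
by rewrite addr0 uvt subrr normr0 mulr0 normr_le0 subr_eq0 addrC subrK => /eqP.
Qed.

End LocalDependence.

(** * Flow of a locally Lipschitz field *)

Section Flow.
Variables (R : realType) (d : nat).
Local Notation X := 'rV[R]_d.
Variables (F : X -> X) (phi : R -> X -> X).
Hypotheses (F_lip : locally_lipschitz F) (phi_flow : is_flow F phi).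

Lemma flow0 x : phi 0 x = x. Proof. by have [] := phi_flow x. Qed.

Lemma flow_solves x : solves F (phi^~ x). Proof. by have [] := phi_flow x. Qed.

Lemma flowD s t x : 0 <= s -> 0 <= t -> phi (s + t) x = phi t (phi s x).
Proof.
move=> s0; move: t; apply: (solves_unique F_lip).
- exact: solves_shift s0 (flow_solves x).
- exact: flow_solves.
- by rewrite addr0 flow0.
Qed.

(** The interval on which [local_dependence] controls solutions starting near
    [phi t x] has a length [tau] that is uniform in a ball. Restarting at a time
    [s] slightly before [t], with [phi s x] in that ball, therefore reaches
    past [t], and [phi q] is a composite of [phi s] with a map that is Lipschitz
    near [phi s x]. *)
Lemma flow_continuous t x : 0 <= t -> {for x, continuous (phi t)}.
Proof.
move: t; apply: real_induction => t t0 IH.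
have [r [tau [r0 tau0 dep]]] := local_dependence (phi t x) F_lip.
have [s [s0 st ts cs rs]] : exists s, [/\ 0 <= s, s <= t, t - s < tau / 2,
    {for x, continuous (phi s)} & `|phi t x - phi s x| < r].
  move: t0; rewrite le_eqVlt => /predU1P[t0|t0].
    exists 0; rewrite -t0 !subrr normr0 divr_gt0//; split=> //.
    rewrite /prop_for /continuous_at flow0.
    by under eq_cvg do rewrite flow0; exact: cvg_id.
  have [a a0 pa] := solves_near (flow_solves x) (ltW t0) r0.
  pose m := Num.min t (Num.min a (tau / 2)).
  have m0 : 0 < m by rewrite !lt_min t0 a0 divr_gt0.
  have mt : m <= t by rewrite ge_min lexx.
  have ma : m <= a by rewrite !ge_min lexx orbT.
  have mtau : m <= tau / 2 by rewrite !ge_min lexx !orbT.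
  have ms : 0 <= t - m / 2 < t by apply/andP; split; lra.
  exists (t - m / 2); split; [lra|lra|lra|exact: IH|].
  apply: pa; first by case/andP: ms.
  by rewrite opprB addrC subrK ger0_norm; lra.
exists (tau / 2); first by rewrite divr_gt0.
move=> q /andP[tq qt].
have qE y : phi q y = phi (q - s) (phi s y).
  by rewrite -flowD ?(addrC s) ?subrK// subr_ge0 (le_trans st).
have qs : 0 <= q - s <= tau by apply/andP; split; lra.
apply/(@cvgrPdist_le _ _ _ (nbhs x)) => e e0.
have e2 : 0 < Num.min (e / 2) (r - `|phi t x - phi s x|).
  by rewrite lt_min divr_gt0//= subr_gt0.
have/(@cvgrPdist_lt _ _ _ (nbhs x)) := cs; move=> /(_ _ e2); apply: filterS => y.
rewrite lt_min => /andP[ye yr].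
rewrite !qE.
have yr' : `|phi t x - phi 0 (phi s y)| < r.
  rewrite flow0 -[_ - _](subrKA (phi s x)) (le_lt_trans (ler_normD _ _))//.
  by move: yr; rewrite ltrBrDl.
have xr' : `|phi t x - phi 0 (phi s x)| < r by rewrite flow0.
have := dep _ _ (flow_solves (phi s x)) (flow_solves (phi s y)) xr' yr' _ qs.
by rewrite !flow0; move: ye; lra.
Qed.

Lemma Traj_invariant x : invariant_set phi (Traj phi x).
Proof.
move=> t t0 _ [_ [s s0 <-] <-]; exists (s + t); last by rewrite flowD.
by rewrite /= addr_ge0.
Qed.

(** This is where continuous dependence on the initial point is needed. *)
Lemma closure_invariant A : invariant_set phi A -> invariant_set phi (closure A).
Proof.
move=> Ainv t t0 _ [p Ap <-] V /(flow_continuous t0) /Ap[q [Aq Vq]].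
by exists (phi t q); split => //; apply: (Ainv t t0); exists q.
Qed.

End Flow.

(** * Lipschitz curves have empty interior *)

Section LipschitzArcs.
Variables (R : realType) (d : nat).
Local Notation X := 'rV[R]_d.

(** Pigeonhole. Place an [N] by [N] grid of mesh [del], proportional to [1 / N],
    in a plane section of the ball. Two distinct grid points are at least [del]
    apart, so a [K]-Lipschitz curve visits them at times at least [del / K]
    apart, and only [O(N)] such times fit into [[0, T]], too few for [N ^ 2] points
    once [N] is large. *)
Lemma lipschitz_arc_not_ball (u : R -> X) (T K e : R) (p : X) : (1 < d)%N ->
  0 < K -> 0 < e ->
  (forall s t, 0 <= s <= T -> 0 <= t <= T -> `|u s - u t| <= K * `|s - t|) ->
  ~ (forall q, `|p - q| < e -> exists2 t, 0 <= t <= T & u t = q).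
Proof.
move=> d1 K0 e0 uK cover.
pose k0 : 'I_d := Ordinal (ltnW d1); pose k1 : 'I_d := Ordinal d1.
have T0 : 0 <= T.
  have [|t /andP[t0 tT] _] := cover p; first by rewrite subrr normr0.
  exact: le_trans tT.
pose c := T * (2 * K) / e.
have c0 : 0 <= c by rewrite !(divr_ge0, mulr_ge0) ?(ltW K0) ?(ltW e0).
(* About [c * N + 1] visiting times fit into [[0, T]], and [N] is chosen so that
   [c <= N - 1], which makes this smaller than [N * N]. *)
pose N := (Num.truncn c).+2.
have N0 : 0 < N%:R :> R by rewrite ltr0n.
pose del := e / (2 * N%:R).
have del0 : 0 < del by rewrite divr_gt0 ?mulr_gt0.
pose grid (ij : 'I_N * 'I_N) : X := p + \row_k
  (if k == k0 then ij.1%:R * del else if k == k1 then ij.2%:R * del else 0).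
have e2 : 0 < e / 2 by rewrite divr_gt0.
have grid_near ij : `|p - grid ij| < e.
  rewrite opprD addrA subrr add0r normrN (@le_lt_trans _ _ (e / 2))//; last lra.
  have small (i : 'I_N) : `|i%:R * del| <= e / 2.
    rewrite ger0_norm; last by rewrite mulr_ge0// ltW.
    have -> : e / 2 = N%:R * del.
      by rewrite /del; field; rewrite lt0r_neq0.
    by rewrite ler_pM2r// ler_nat ltnW.
  apply: norm_le_coord => [|k]; first exact: ltW.
  by rewrite mxE; case: ifP => // _; case: ifP => // _; rewrite normr0 ltW.
have /choice[tm tmP] : forall ij, exists t, 0 <= t <= T /\ u t = grid ij.
  by move=> ij; have [t tT ut] := cover _ (grid_near ij); exists t.
pose B := Num.truncn (T * (K / del)).
have Kdel0 : 0 < K / del by rewrite divr_gt0.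
(* Points visited within the same time slot of length [del / K] coincide. *)
pose slot ij := Num.truncn (tm ij * (K / del)).
have slotB ij : (slot ij < B.+1)%N.
  by rewrite ltnS; apply: le_truncn; rewrite ler_pM2r//; case: (tmP ij) => /andP[].
pose f ij : 'I_B.+1 := Ordinal (slotB ij).
have coord_eq (a b : 'I_N) : `|a%:R * del - b%:R * del| < del -> a = b.
  rewrite -mulrBl normrM (gtr0_norm del0) -[ltRHS]mul1r ltr_pM2r// => ab.
  apply/val_inj/eqP; rewrite /= eqn_leq -ltnS -(ltnS b) -!(ltr_nat R) -!natr1.
  by move: ab; rewrite ltr_norml => /andP[? ?]; apply/andP; split; lra.
have finj : injective f.
  move=> [i j] [i' j'] /(congr1 val)/= slotE.
  have close : `|grid (i, j) - grid (i', j')| < del.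
    have [tT <-] := tmP (i, j); have [tT' <-] := tmP (i', j').
    rewrite (le_lt_trans (uK _ _ tT tT'))//.
    have tge0 t : 0 <= t <= T -> 0 <= t * (K / del).
      by case/andP => t0 _; rewrite mulr_ge0// ltW.
    have /andP[h1 h2] := truncn_itv (tge0 _ tT).
    have /andP[h3 h4] := truncn_itv (tge0 _ tT').
    rewrite -/(slot _) in h1 h2; rewrite -/(slot _) -slotE in h3 h4.
    have : `|(tm (i, j) - tm (i', j')) * (K / del)| < 1.
      rewrite mulrBl ltr_norml; move: h1 h2 h3 h4; rewrite -natr1 => *.
      by apply/andP; split; lra.
    by rewrite normrM (gtr0_norm Kdel0) mulrA ltr_pdivrMr// mul1r mulrC.
  have coordE k : (grid (i, j) - grid (i', j')) 0 k =
      (if k == k0 then i%:R * del else if k == k1 then j%:R * del else 0) -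
      (if k == k0 then i'%:R * del else if k == k1 then j'%:R * del else 0).
    by rewrite !mxE opprD addrACA subrr add0r.
  have := le_lt_trans (coord_le_norm _ k0) close.
  rewrite coordE eqxx => /coord_eq ->.
  have := le_lt_trans (coord_le_norm _ k1) close.
  by rewrite coordE /= => /coord_eq ->.
have := leq_card f finj; rewrite card_prod !card_ord -(ler_nat R) natrM -natr1.
have : B%:R <= c * N%:R.
  have -> : c * N%:R = T * (K / del).
    by rewrite /c /del; field; rewrite !lt0r_neq0.
  by rewrite truncn_le mulr_ge0// ltW.
have : c * N%:R <= (N%:R - 1) * N%:R.
  by rewrite ler_pM2r// /N -natr1 addrK ltW// truncnS_gt.
have : 2 <= N%:R :> R by rewrite ler_nat.
rewrite mulrBl mul1r; lra.
Qed.

End LipschitzArcs.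

(** * Recurrence and transitivity *)

Section Recurrence.
Variables (R : realType) (d : nat).
Hypothesis d_gt1 : (1 < d)%N.
Local Notation X := 'rV[R]_d.
Variables (F : X -> X) (phi : R -> X -> X).
Hypotheses (F_lip : locally_lipschitz F) (phi_flow : is_flow F phi).
Let traj_solves := flow_solves phi_flow.

Lemma locally_lipschitz_continuous : continuous F.
Proof.
move=> z; have [r [L [M [r0 L0 _ FL _]]]] := lipschitz_bounded_ball z F_lip.
apply/(@cvgrPdist_lt _ _ _ (nbhs z)) => e e0.
have zr : `|z - z| < r by rewrite subrr normr0.
have m0 : 0 < Num.min r (e / L) by rewrite lt_min r0 divr_gt0.
near_simpl; apply/(nbhs_normP z); exists (Num.min r (e / L)) => //= y /=.
rewrite lt_min => /andP[yr]; rewrite ltr_pdivlMr// mulrC.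
exact: le_lt_trans (FL _ _ zr yr).
Qed.

(** The speed is continuous along the trajectory, hence bounded on [[0, T]]. *)
Lemma Traj_lipschitz x T : exists2 K, 0 < K & forall s t,
  0 <= s <= T -> 0 <= t <= T -> `|phi s x - phi t x| <= K * `|s - t|.
Proof.
have [T0|T0] := leP 0 T; last first.
  exists 1 => // s t /andP[s0 sT]; have := le_trans s0 sT.
  by rewrite leNgt T0.
have cF : {within `[0, T], continuous (fun t => `|F (phi t x)|)}.
  move=> t; apply: cvg_norm.
  have cu : {within `[0, T], continuous phi^~ x}.
    exact: solves_within (traj_solves x) (lexx 0).
  exact: cvg_comp (cu t) (@locally_lipschitz_continuous (phi t x)).
have [c _ Fc] := EVT_max T0 cF.
pose K := `|F (phi c x)| + 1.
exists K => [|s t]; first by rewrite ltr_wpDl.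
have le_case a b : 0 <= a -> a <= b -> b <= T ->
    `|phi b x - phi a x| <= K * (b - a).
  move=> a0 ab bT; apply: (@mean_value_le _ _ (phi^~ x) (F \o phi^~ x)) => //.
  - by rewrite addr_ge0.
  - exact: solves_within (traj_solves x) a0.
  - by move=> q /andP[qa _]; apply: (traj_solves x).1; exact: le_lt_trans qa.
  - move=> q /andP[qa qb]; rewrite ler_wpDr//; apply: Fc.
    by rewrite in_itv/= (ltW (le_lt_trans a0 qa)) (ltW (lt_le_trans qb bT)).
move=> /andP[s0 sT] /andP[t0 tT].
have [st|ts] := leP s t.
  by rewrite distrC [`|s - t|]distrC [`|t - s|]ger0_norm ?subr_ge0//; exact: le_case.
by rewrite [`|s - t|]gtr0_norm ?subr_gt0//; apply: le_case => //; exact: ltW.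
Qed.

(** If the trajectory did not visit [V] after time [T], every point of [V], being
    a limit of points of the trajectory, would lie on the arc run up to time [T],
    which is closed. That arc would then contain a ball. *)
Lemma recurrence x (V : set X) T : open V -> V !=set0 ->
  V `<=` closure (Traj phi x) -> exists2 t, T < t & V (phi t x).
Proof.
move=> oV [p Vp] Vcl; apply: contrapT => nret.
pose arc := phi^~ x @` `[0, T]%classic.
have arc_closed : closed arc.
  apply: compact_closed; first exact: norm_hausdorff.
  apply: continuous_compact; last exact: segment_compact.
  exact: solves_within (traj_solves x) (lexx 0).
have Varc : V `<=` arc.
  move=> q Vq; apply: contrapT => narc.
  have : nbhs q (V `&` ~` arc).
    by apply: open_nbhs_nbhs; split => //; apply: openI => //; exact: closed_openC.
  move=> /(Vcl _ Vq)[_ [[t /= t0 <-] [Vt arct]]].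
  have [tT|Tt] := leP t T; last by apply: nret; exists t.
  by apply: arct; exists t; rewrite //= in_itv/= t0.
have /nbhs_normP[e /= e0 eV] : nbhs p V by exact: open_nbhs_nbhs.
have [K K0 lipK] := Traj_lipschitz x T.
apply: (lipschitz_arc_not_ball d_gt1 K0 e0 lipK (p := p)) => q /eV/Varc[t].
by rewrite /= in_itv/= => tT <-; exists t.
Qed.

(** Recurrence is used twice: to see that the trajectory never leaves [U], since
    it would have to come back to it, and to find late visits to [U `&` V2]. Being
    open in the whole space, unlike the relatively open sets themselves, is what
    makes [U `&` V2] a legitimate target for [recurrence]. *)
Lemma transitive_on_closure_Traj x (U : set X) :
  open U -> U !=set0 -> U `<=` closure (Traj phi x) ->
  invariant_set phi (~` U) -> transitive_on phi (closure (Traj phi x)).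
Proof.
move=> oU U0 Ucl Uinv.
have trajU t : 0 <= t -> U (phi t x).
  move=> t0; apply: contrapT => nU.
  have [s ts Us] := recurrence t oU U0 Ucl.
  have : (~` U) (phi s x).
    rewrite -(subrK t s) addrC (flowD F_lip phi_flow)// ?subr_ge0 1?ltW//.
    by apply: (Uinv (s - t)); [rewrite subr_ge0 ltW | exists (phi t x)].
  exact.
have visit (O : set X) : open O -> closure (Traj phi x) `&` O !=set0 ->
    exists2 t, 0 <= t & O (phi t x).
  move=> oO [q [clq Oq]].
  have [_ [[t /= t0 <-] Ot]] := clq _ (open_nbhs_nbhs (conj oO Oq)).
  by exists t.
have in_cl t : 0 <= t -> closure (Traj phi x) (phi t x).
  by move=> t0; apply: subset_closure; exists t.
move=> _ _ [V1 oV1 ->] [V2 oV2 ->] /(visit _ oV1)[s s0 V1s] /(visit _ oV2)[q q0 V2q].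
have [| | |t st [Ut V2t]] := @recurrence x (U `&` V2) s.
- exact: openI.
- by exists (phi q x); split => //; exact: trajU.
- by move=> y [/Ucl].
exists (t - s); first by rewrite subr_gt0.
exists (phi t x); split.
  exists (phi s x); first by split => //; exact: in_cl.
  by rewrite -(flowD F_lip phi_flow)// ?subr_ge0 ?ltW// addrC subrK.
by split => //; apply: in_cl; exact: ltW (le_lt_trans s0 st).
Qed.

End Recurrence.

(** * Discoverability and density *)

Section DiscoverabilityDensity.
Variables (R : realType) (d : nat).
Local Notation X := 'rV[R]_d.
Variables (F : X -> X) (phi : R -> X -> X).
Hypothesis phi_flow : is_flow F phi.

(** A field that differs from [F] by a bump supported in a ball missed by all the
    trajectories has the same solutions along them. *)
Lemma discoverable_dense n (y : 'I_n -> X) : (0 < d)%N ->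
  discoverable phi F y -> forall p, exists i, closure (Traj phi (y i)) p.
Proof.
move=> d0 [[cF _] Funiq] p; apply: contrapT => /forallNP np.
have /nbhs_normP[e /= e0 eN] :
    nbhs p (~` \bigcup_(i in [set: 'I_n]) closure (Traj phi (y i))).
  apply: open_nbhs_nbhs; split; last by move=> [i _ /np].
  apply: closed_openC; apply: closed_bigcup; first exact: finite_finset.
  by move=> i _; exact: closed_closure.
(* Twice the positive part of [e - `|p - q|], so zero outside the ball. *)
pose bump (q : X) : R := (e - `|p - q|) + `|e - `|p - q| |.
pose G q := F q + bump q *: const_mx 1.
have cG : continuous G.
  have cdist : continuous (fun q : X => `|p - q|).
    move=> q; apply: continuous_comp; last exact: norm_continuous.
    by apply: continuousB; [exact: cst_continuous | move=> ?; exact: cvg_id].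
  have cgap : continuous (fun q : X => e - `|p - q|).
    by move=> q; apply: (@cvgB _ _ _ (nbhs q)); [exact: cst_continuous | exact: cdist].
  move=> q; apply: (@cvgD _ _ _ (nbhs q)); first exact: cF.
  apply: (@cvgZ _ _ _ (nbhs q)); last exact: cvg_cst.
  apply: (@cvgD _ _ _ (nbhs q)); first exact: cgap.
  by apply: (@cvg_norm _ _ _ (nbhs q)); exact: cgap.
have GF : F = G.
  apply: Funiq; split => // i.
  apply: (solves_eq_field (F := F)); first exact: flow_solves.
  move=> t t0; rewrite /G /bump.
  have [pe|ep] := ltP `|p - phi t (y i)| e.
    by have []:= eN _ pe; exists i => //; apply: subset_closure; exists t.
  by rewrite ler0_norm ?subr_le0// subrr scale0r addr0.
have := congr1 (fun H : X -> X => (H p - F p) 0 (Ordinal d0)) GF.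
rewrite /G /bump !subrr normr0 subr0 (gtr0_norm e0) addrAC subrr add0r !mxE mulr1.
by move/eqP; rewrite lt_eqF// addr_gt0.
Qed.

(** Two continuous fields solved by the same trajectories agree along them, hence
    on the closed set where the trajectories are dense. *)
Lemma dense_discoverable n (y : 'I_n -> X) : continuous F ->
  (forall p, exists i, closure (Traj phi (y i)) p) -> discoverable phi F y.
Proof.
move=> cF dense; split; first by split => // i; exact: flow_solves.
move=> G [cG Gsol]; apply/funext => p; have [i ip] := dense p.
pose gap q := F q - G q.
have cgap : continuous gap.
  by move=> q; apply: (@cvgB _ _ _ (nbhs q)); [exact: cF | exact: cG].
have agree : Traj phi (y i) `<=` gap @^-1` [set 0].
  move=> _ [t /= t0 <-] /=.
  by rewrite /gap (solves_field_eq (flow_solves phi_flow _) (Gsol i) t0) subrr.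
have : closed (gap @^-1` [set 0]).
  apply: (continuous_closedP _).1 => //.
  exact/accessible_closed_set1/hausdorff_accessible/norm_hausdorff.
move=> /closure_id agE; have := closureS agree ip.
by rewrite -agE => /subr0_eq.
Qed.

End DiscoverabilityDensity.

(** * Irredundant covers and the dichotomy *)

(** A subfamily that is minimal for inclusion among those that cover: each of its
    members owns a point, for otherwise it could be dropped. *)
Lemma irredundant_subcover (I : finType) (T : Type) (C : I -> set T) :
  (forall p, exists i, C i p) ->
  exists J : {set I}, (forall p, exists2 i, i \in J & C i p) /\
    (forall i, i \in J -> exists p, forall j, j \in J -> j != i -> ~ C j p).
Proof.
move=> cov; pose P (J : {set I}) := `[< forall p, exists2 i, i \in J & C i p >].
have [|J /minsetP[/asboolP PJ minJ] _] := @minset_exists _ P [set: I].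
  by apply/asboolP => p; have [i Ci] := cov p; exists i; rewrite ?inE.
exists J; split => // i iJ; apply: contrapT => /forallNP np.
have JE : J :\ i = J.
  apply: minJ; last exact: subsetDl.
  apply/asboolP => p; have /existsNP[j /not_implyP[jJ /not_implyP[ji /contrapT Cj]]] := np p.
  by exists j; rewrite // in_setD1 ji.
by move: iJ; rewrite -JE in_setD1 eqxx.
Qed.

Theorem proposition4p2 (R : realType) (d : nat) (d_gt1 : (1 < d)%N)
    (F : 'rV[R]_d -> 'rV[R]_d) (F_lip : locally_lipschitz F)
    (phi : R -> 'rV[R]_d -> 'rV[R]_d) (phi_flow : is_flow F phi)
    (n : nat) (x : 'I_n -> 'rV[R]_d) (F_disc : discoverable phi F x) :
  (topologically_transitive phi /\
     exists i : 'I_n, discoverable phi F (fun _ : 'I_1 => x i))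
  \/
  (exists k : nat, (1 < k <= n)%N /\
     exists s : 'I_k -> 'I_n, injective s /\
       let C := fun j : 'I_k => closure (Traj phi (x (s j))) in
       [/\ (forall j, [/\ C j `<` setT, closed (C j) & invariant_set phi (C j)]),
           setT = \bigcup_(j in [set: 'I_k]) C j,
           (forall j, transitive_on phi (C j)) &
           discoverable phi F (fun j : 'I_k => x (s j))]).
Proof.
have cF : continuous F by case: F_disc => [[]].
have cov := discoverable_dense phi_flow (ltnW d_gt1) F_disc.
have [J [Jcov Jirr]] := irredundant_subcover cov.
have Cinv i : invariant_set phi (closure (Traj phi (x i))).
  apply: (closure_invariant F_lip phi_flow).
  exact: (Traj_invariant F_lip phi_flow).
have Ctrans i : i \in J -> transitive_on phi (closure (Traj phi (x i))).
  move=> iJ; have [p pi] := Jirr i iJ.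
  (* [U] is contained in the closure through [x i] because [J] covers, and it is
     non-empty because [J] is irredundant. *)
  pose U := ~` \bigcup_(j in [set` J :\ i]) closure (Traj phi (x j)).
  apply: (transitive_on_closure_Traj d_gt1 F_lip phi_flow (U := U)).
  - apply: closed_openC; apply: closed_bigcup; first exact: finite_finset.
    by move=> j _; exact: closed_closure.
  - exists p => -[j /=]; rewrite in_setD1 => /andP[ji jJ]; exact: pi.
  - move=> q Uq; have [j jJ Cj] := Jcov q.
    have [<-//|ji] := eqVneq j i.
    by case: Uq; exists j; rewrite //= in_setD1 ji.
  - rewrite setCK => t t0 _ [q [j jJ Cj] <-]; exists j => //.
    by apply: (Cinv j t t0); exists q.
have [J1|J1] := leqP #|J| 1%N.
  left; have [i iJ _] := Jcov 0.
  have Ji : J = [set i]%SET.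
    by apply/eqP; rewrite eq_sym eqEcard finset.sub1set iJ cards1.
  have Ci p : closure (Traj phi (x i)) p.
    by have [j] := Jcov p; rewrite Ji inE => /eqP ->.
  split; last by exists i; apply: dense_discoverable => // p; exists ord0.
  rewrite /topologically_transitive (_ : setT = closure (Traj phi (x i))); first exact: Ctrans.
  by apply/seteqP; split.
right; exists #|J|; split; first by rewrite J1 -[leqRHS]card_ord max_card.
pose s (j : 'I_#|J|) : 'I_n := enum_val j.
have s_onto i : i \in J -> exists j, s j = i.
  by move=> iJ; exists (enum_rank_in iJ i); rewrite /s enum_rankK_in.
have scov p : exists j, closure (Traj phi (x (s j))) p.
  by have [i /s_onto[j <-] Ci] := Jcov p; exists j.
exists s; split; first exact: enum_val_inj.
split.
- move=> j; split; [split => // Cj | exact: closed_closure | exact: Cinv].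
  have [i [iJ ij]] : exists i, i \in J /\ i != s j.
    have /card_gt0P[i] : (0 < #|J :\ s j|)%N.
      by move: J1; rewrite (cardsD1 (s j)) enum_valP.
    by rewrite in_setD1 => /andP[ij iJ]; exists i.
  have [p pi] := Jirr i iJ.
  by apply: (pi (s j)); rewrite ?enum_valP 1?eq_sym//; exact: Cj.
- by apply/seteqP; split => // p _; have [j Cj] := scov p; exists j.
- by move=> j; apply: Ctrans; exact: enum_valP.
- exact: dense_discoverable.
Qed.
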